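(* For every digraph $D$ there is a constant $C_D>0$ such that for all integers $n\ge 1$, \[\max_{v\in V(D)}\{d^+(v)-d^-(v)\}\,n\le S_D(n\cdot\mathbf{1})\le \max_{v\in V(D)}\{d^+(v)-d^-(v)\}\,n+C_D\sqrt{n}.\]
   Context: A digraph $D$ has a finite vertex set $V(D)$ and a set $E(D)$ of ordered pairs of distinct vertices (arcs), with at most one arc between any pair of vertices. $N^+(v)=\{u:vu\in E(D)\}$, $N^-(v)=\{u:uv\in E(D)\}$, $d^\pm(v)=|N^\pm(v)|$. $\mathbf{1}$ is the all-ones vector indexed by $V(D)$. A restriction vector is a vector $\mathbf{r}$ of nonnegative integers indexed by $V(D)$; $\operatorname{supp}(\mathbf{r})=\{v:\mathbf{r}_v>0\}$; $\delta_v$ is the indicator vector of $v$. Semi-restricted $D$-game with parameter $\mathbf{r}$: two players, Rei and Norman, play $\sum_u\mathbf{r}_u$ rounds; in each round both simultaneously choose a vertex, Rei being required to choose each $u$ exactly $\mathbf{r}_u$ times overall, Norman unrestricted. A strategy for Norman is a function $\mathcal{N}$ assigning to each restriction vector a random variable with values in $V(D)$; a strategy for Rei is a function $\mathcal{R}$ assigning to each restriction vector $\mathbf{r}$ a random variable with values in $\operatorname{supp}(\mathbf{r})$ (choices are independent across players and rounds). The score for Norman is defined recursively: $0$ if $\mathbf{r}=0$; otherwise with $x=\mathcal{N}(\mathbf{r})$, $y=\mathcal{R}(\mathbf{r})$, Norman gains $+1$ if $y\in N^+(x)$, $-1$ if $y\in N^-(x)$, $0$ otherwise, and play continues from $\mathbf{r}-\delta_y$.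 $S_D(\mathbf{r};\mathcal{N},\mathcal{R})$ is the expected score, $S_D(\mathbf{r};\mathcal{R})=\max_{\mathcal{N}}S_D(\mathbf{r};\mathcal{N},\mathcal{R})$, and $S_D(\mathbf{r})=\min_{\mathcal{R}}S_D(\mathbf{r};\mathcal{R})$ (Norman's expected score under optimal play). *)

(* Defs.v *)
From HB Require Import structures.
From mathcomp Require Import all_boot all_order all_algebra.
From mathcomp Require Import all_classical all_reals all_analysis.

Set Implicit Arguments.
Unset Strict Implicit.
Unset Printing Implicit Defensive.

Import Order.TTheory GRing.Theory Num.Theory.
Import numFieldNormedType.Exports.

Local Open Scope classical_set_scope.
Local Open Scope ring_scope.

Record digraph := Digraph {
  vertex :> finType;
  arc : rel vertex;
  arc_irrefl : irreflexive arc;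
  arc_antisym : forall u v, arc u v -> ~~ arc v u }.

Section Digraph.
Variable D : digraph.

Definition outN (v : D) : {set D} := [set u | arc v u]%SET.
Definition inN (v : D) : {set D} := [set u | arc u v]%SET.

Definition excess (v : D) : int := #|outN v|%:Z - #|inN v|%:Z.

(* [v0] only witnesses that D has a vertex: the value does not depend on it. *)
Definition max_excess (v0 : D) : int :=
  \big[Num.max/excess v0]_(v : D) excess v.

Lemma max_excess_ge (v0 v : D) : excess v <= max_excess v0.
Proof. exact: le_bigmax. Qed.

Lemma max_excess_attained (v0 : D) : exists v, max_excess v0 = excess v.
Proof.
rewrite /max_excess; elim/big_ind: _ => [|_ _ [u ->] [w ->]|v _].
- by exists v0.
- by rewrite /Num.max; case: ifP => _; [exists w | exists u].
- by exists v.
Qed.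

Definition restriction := {ffun D -> nat}.

Definition supp (r : restriction) : {set D} := [set v | (0 < r v)%N]%SET.

Definition rounds (r : restriction) : nat := (\sum_v r v)%N.

(* r - delta_y; only meaningful for y in supp r *)
Definition use_up (r : restriction) (y : D) : restriction :=
  [ffun v => (r v - (v == y))%N].

End Digraph.

(* Choices are independent across players and rounds, so a random vertex enters
   the game only through its law. *)
Record vdist (R : realType) (V : finType) := VDist {
  pmf :> V -> R;
  pmf_ge0 : forall v, 0 <= pmf v;
  pmf_sum1 : \sum_v pmf v = 1 }.

Section Game.
Variables (R : realType) (D : digraph).

Definition norman_strategy := restriction D -> vdist R D.

(* For r = 0 no law is supported in supp r; the game is then over, and the value
   of the strategy is irrelevant. *)
Record rei_strategy := ReiStrategy {
  rei :> restriction D -> vdist R D;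
  rei_supp : forall r, supp r != finset.set0 ->
    forall y, rei r y != 0 -> y \in supp r }.

(* Norman's gain when he plays x and Rei plays y *)
Definition gain (x y : D) : R :=
  if y \in outN x then 1 else if y \in inN x then -1 else 0.

Fixpoint score_rec (k : nat) (r : restriction D)
    (N : norman_strategy) (S : rei_strategy) : R :=
  if k is k'.+1 then
    \sum_x \sum_y N r x * S r y * (gain x y + score_rec k' (use_up r y) N S)
  else 0.

(* S_D(r; N, R): every round decreases [rounds r] by one, so the recursion stops
   exactly when the restriction vector becomes 0; see scoreE below. *)
Definition score r N S : R := score_rec (rounds r) r N S.

(* S_D(r; R); the supremum is a maximum by score_against_max below *)
Definition score_against r (S : rei_strategy) : R :=
  sup (range (fun N : norman_strategy => score r N S)).

(* S_D(r); the infimum is a minimum by game_value_min below *)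
Definition game_value r : R := inf (range (score_against r)).

Lemma rounds_eq0 (r : restriction D) : (rounds r == 0%N) = (supp r == finset.set0).
Proof.
rewrite /rounds sum_nat_eq0; apply/forallP/eqP => [r0|r0 v] /=.
  by apply/setP => v; rewrite !inE; move: (r0 v) => /eqP ->.
by have := finset.in_set0 v; rewrite -r0 inE lt0n => /negbFE.
Qed.

Lemma rounds_use_up (r : restriction D) y :
  y \in supp r -> rounds r = (rounds (use_up r y)).+1.
Proof.
rewrite inE => ry; rewrite /rounds (bigD1 y)//= [in RHS](bigD1 y)//= ffunE eqxx.
rewrite -addSn subn1 prednK//; congr addn; apply: eq_bigr => v /negPf vy.
by rewrite ffunE vy subn0.
Qed.

Lemma scoreE r N S : score r N S =
  if supp r == finset.set0 then 0 else
  \sum_x \sum_y N r x * S r y * (gain x y + score (use_up r y) N S).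
Proof.
rewrite /score -rounds_eq0; case k0: (rounds r) => [|k]//=.
apply: eq_bigr => x _; apply: eq_bigr => y _.
have [->|Sy] := eqVneq (S r y) 0; first by rewrite mulr0 !mul0r.
have /rounds_use_up : y \in supp r by apply: rei_supp Sy; rewrite -rounds_eq0 k0.
by rewrite k0 => -[->].
Qed.


Section Optimal.
Variable v0 : D.

Fact point_ge0 (x v : D) : 0 <= (v == x)%:R :> R. Proof. exact: ler0n. Qed.

Fact point_sum1 (x : D) : \sum_v (v == x)%:R = 1 :> R.
Proof.
by rewrite (bigD1 x)//= eqxx big1 ?addr0// => v /negPf ->.
Qed.

Definition point (x : D) : vdist R D := VDist (point_ge0 x) (point_sum1 x).

Definition bigmax (h : D -> R) : R := \big[Num.max/h v0]_x h x.

Lemma bigmax_attained h : exists x, bigmax h = h x.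
Proof.
rewrite /bigmax; elim/big_ind: _ => [|_ _ [u ->] [w ->]|v _].
- by exists v0.
- by rewrite /Num.max; case: ifP => _; [exists w | exists u].
- by exists v.
Qed.

Lemma average_le_bigmax (p : vdist R D) h : \sum_x p x * h x <= bigmax h.
Proof.
rewrite -[leRHS]mul1r -(pmf_sum1 p) mulr_suml ler_sum// => x _.
by rewrite ler_wpM2l ?pmf_ge0// /bigmax; exact: le_bigmax.
Qed.

(* Norman's expected score against S when he maximizes the gain of every round;
   his choices do not influence the later restriction vectors. *)
Fixpoint best_rec k (r : restriction D) (S : rei_strategy) : R :=
  if k is k'.+1 then
    bigmax (fun x => \sum_y S r y * gain x y)
    + \sum_y S r y * best_rec k' (use_up r y) S
  else 0.

Lemma score_recS k r (N : norman_strategy) (S : rei_strategy) :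
  score_rec k.+1 r N S =
  \sum_x N r x * (\sum_y S r y * gain x y)
  + \sum_y S r y * score_rec k (use_up r y) N S.
Proof.
rewrite /= -[X in _ = _ + X]mul1r -(pmf_sum1 (N r)) mulr_suml -big_split/=.
apply: eq_bigr => x _; rewrite !mulr_sumr -big_split/=; apply: eq_bigr => y _.
by rewrite mulrDr !mulrA.
Qed.

Lemma score_rec_le k r N S : score_rec k r N S <= best_rec k r S.
Proof.
elim: k r => [|k IH] r //; rewrite score_recS [leRHS]/= lerD//.
  exact: average_le_bigmax.
by apply: ler_sum => y _; rewrite ler_wpM2l ?pmf_ge0.
Qed.

Lemma score_rec_best S : exists N, forall k r, score_rec k r N S = best_rec k r S.
Proof.
pose f r := cid (bigmax_attained (fun x => \sum_y S r y * gain x y)).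
exists (fun r => point (sval (f r))); elim => [|k IH] r //.
rewrite score_recS [RHS]/=; congr (_ + _).
  case: (f r) => z /= ->; rewrite (bigD1 z)//= eqxx mul1r [X in _ + X]big1 ?addr0//.
  by move=> x /negPf ->; rewrite mul0r.
by apply: eq_bigr => y _; rewrite IH.
Qed.

Lemma score_againstE r S : score_against r S = best_rec (rounds r) r S.
Proof.
have [N NS] := score_rec_best S; apply/eqP; rewrite eq_le; apply/andP; split.
  apply: ge_sup; first by exists (score r N S), N.
  by move=> _ [N' _ <-]; exact: score_rec_le.
apply: sup_upper_bound; last by exists N => //; exact: NS.
split; first by exists (score r N S), N.
by exists (best_rec (rounds r) r S) => _ [N' _ <-]; exact: score_rec_le.
Qed.

Definition simplex (A : {set D}) : set (D -> R) :=
  [set p | [/\ forall v, 0 <= p v, \sum_v p v = 1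
             & forall v, p v != 0 -> v \in A]].

Definition continuation (f : D -> R) (p : D -> R) : R :=
  bigmax (fun x => \sum_y p y * gain x y) + \sum_y p y * f y.

Lemma continuation_min (A : {set D}) f : A != finset.set0 ->
  exists2 p, simplex A p & forall q, simplex A q -> continuation f p <= continuation f q.
Proof.
move=> /finset.set0Pn[a aA].
pose T := prod_topology (fun _ : D => R^o).
have sumC (g : D -> R) : continuous (fun p : T => \sum_y p y * g y : R^o).
  apply: (@continuous_big R^o D +%R 0 xpredT _ T (index_enum D)
    (fun y (p : T) => p y * g y : R^o)) => [|y _ q]; first exact: add_continuous.
  apply: (@continuousM R T (fun p : T => p y) (fun=> g y)); last exact: cst_continuous.
  exact: (@proj_continuous D (fun=> R^o) y).
pose L x (p : T) : R^o := \sum_y p y * gain x y.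
have cM (s : seq D) : continuous (fun p : T => \big[Num.max/L v0 p]_(x <- s) L x p : R^o).
  elim: s => [|x s IH] p.
    rewrite (_ : (fun p : T => _) = L v0); first exact: sumC.
    by apply/funext => q; rewrite big_nil.
  rewrite (_ : (fun p : T => _) = L x \max (fun p : T => \big[Num.max/L v0 p]_(x <- s) L x p : R^o)).
    by apply: continuous_max; [exact: sumC|exact: IH].
  by apply/funext => q; rewrite big_cons.
have cF : continuous (continuation f : T -> R^o).
  by move=> p; apply: continuousD; [exact: cM|exact: sumC].
pose I v : set R^o := if v \in A then `[0, 1]%classic else [set 0].
pose B : set T := [set p | forall v, I v (p v)].
have cB : compact (B : set T).
  apply: (@tychonoff D (fun=> R^o) I) => v; rewrite /I.
  by case: (v \in A); [exact: segment_compact|exact: compact_set1].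
pose C : set T := [set p | \sum_v p v * 1 = 1 :> R^o].
have cC : closed C.
  apply: (@preimage_closed T R^o (fun p : T => \sum_v p v * 1 : R^o) [set 1]).
    by move=> p _; exact: sumC.
  exact: closed_eq.
have SE : simplex A = B `&` C.
  apply/seteqP; split=> [p [p0 p1 pA]|p [pB pC]].
    split; last by rewrite /C/=; under eq_bigr do rewrite mulr1.
    move=> v; rewrite /I; case: ifPn => vA /=; last by apply: contraNeq vA => /pA.
    rewrite in_itv/= p0/= -p1 (bigD1 v)//= lerDl sumr_ge0//.
  split.
  - by move=> v; move: (pB v); rewrite /I; case: ifP => _ /=; [rewrite in_itv/= => /andP[]|move=> ->].
  - by move: pC; rewrite /C/=; under eq_bigr do rewrite mulr1.
  - by move=> v; move: (pB v); rewrite /I; case: ifP => //= _ ->; rewrite eqxx.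
have S0 : simplex A !=set0.
  exists (point a); split; [exact: point_ge0|exact: point_sum1|].
  by move=> v /=; case: (v =P a) => [->//|_]; rewrite eqxx.
have [||c /set_mem cA cmin] := @compact_EVT_min T R (continuation f) (simplex A) S0.
- by rewrite SE; exact: compact_closedI.
- exact: continuous_subspaceT.
- by exists c => // q qA; apply: cmin; exact/mem_set.
Qed.

Fixpoint value_rec k (r : restriction D) : R :=
  if k is k'.+1 then
    inf [set continuation (fun y => value_rec k' (use_up r y)) p | p in simplex (supp r)]
  else 0.

Lemma value_recS k r : supp r != finset.set0 ->
  exists p : vdist R D, [/\ forall y, p y != 0 -> y \in supp r,
    value_rec k.+1 r = continuation (fun y => value_rec k (use_up r y)) p
    & forall q, simplex (supp r) q ->
        value_rec k.+1 r <= continuation (fun y => value_rec k (use_up r y)) q].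
Proof.
move=> r0.
have [p [p0 p1 pr] pmin] := continuation_min (fun y => value_rec k (use_up r y)) r0.
have pE : value_rec k.+1 r = continuation (fun y => value_rec k (use_up r y)) p.
  apply/eqP; rewrite eq_le; apply/andP; split.
    apply: ge_inf; last by exists p.
    by exists (continuation (fun y => value_rec k (use_up r y)) p) => _ [q /pmin ? <-].
  apply: lb_le_inf; first by exists (continuation (fun y => value_rec k (use_up r y)) p), p.
  by move=> _ [q /pmin ? <-].
exists (VDist p0 p1); split=> // q /pmin; by rewrite pE.
Qed.

Lemma value_rec_le k r S : rounds r = k -> value_rec k r <= best_rec k r S.
Proof.
elim: k r => [//|k IH] r rk.
have r0 : supp r != finset.set0 by rewrite -rounds_eq0 rk.
have Sr : simplex (supp r) (S r).
  by split; [exact: pmf_ge0|exact: pmf_sum1|exact: rei_supp].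
have [p [_ _ /(_ _ Sr)/le_trans]] := value_recS k r0; apply.
rewrite /continuation [leRHS]/= lerD2l; apply: ler_sum => y _.
have [->|Sy] := eqVneq (S r y) 0; first by rewrite !mul0r.
rewrite ler_wpM2l ?pmf_ge0// IH//.
by have /rounds_use_up := rei_supp r0 Sy; rewrite rk => -[].
Qed.

Lemma value_rec_best :
  exists S, forall k r, rounds r = k -> best_rec k r S = value_rec k r.
Proof.
have H r : exists p : vdist R D, supp r != finset.set0 ->
    (forall y, p y != 0 -> y \in supp r) /\
    value_rec (rounds r) r =
      continuation (fun y => value_rec (rounds r).-1 (use_up r y)) p.
  have [r0|r0] := eqVneq (supp r) finset.set0; first by exists (point v0).
  have [p [pr pE _]] := value_recS (rounds r).-1 r0.
  exists p => _; split=> //; rewrite -pE prednK//.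
  by rewrite lt0n rounds_eq0.
pose s r := sval (cid (H r)).
have sP r : supp r != finset.set0 -> (forall y, s r y != 0 -> y \in supp r) /\
    value_rec (rounds r) r =
      continuation (fun y => value_rec (rounds r).-1 (use_up r y)) (s r).
  exact: svalP (cid (H r)).
exists (@ReiStrategy s (fun r r0 => (sP r r0).1)).
elim=> [//|k IH] r rk.
have r0 : supp r != finset.set0 by rewrite -rounds_eq0 rk.
have [sr] := sP r r0; rewrite rk => ->; rewrite [LHS]/= /continuation.
congr (_ + _); apply: eq_bigr => y _.
have [->|sy] := eqVneq (s r y) 0; first by rewrite !mul0r.
by rewrite IH//; have := rounds_use_up (sr y sy); rewrite rk => -[].
Qed.

Lemma game_valueE r : game_value r = value_rec (rounds r) r.
Proof.
have [S SE] := value_rec_best; apply/eqP; rewrite eq_le; apply/andP; split.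
  rewrite -(SE _ r)// -score_againstE; apply: ge_inf; last by exists S.
  exists (value_rec (rounds r) r) => _ [S' _ <-].
  by rewrite score_againstE value_rec_le.
apply: lb_le_inf; first by exists (score_against r S), S.
by move=> _ [S' _ <-]; rewrite score_againstE value_rec_le.
Qed.

End Optimal.

Lemma score_against_max (v0 : D) r S :
  (exists N, score_against r S = score r N S) /\
  forall N, score r N S <= score_against r S.
Proof.
rewrite (score_againstE v0); split=> [|N]; last exact: score_rec_le.
by have [N NE] := score_rec_best v0 S; exists N; rewrite /score NE.
Qed.

Lemma game_value_min (v0 : D) r :
  (exists S, game_value r = score_against r S) /\
  forall S, game_value r <= score_against r S.
Proof.
rewrite (game_valueE v0); split=> [|S].
  have [S SE] := value_rec_best v0.
  by exists S; rewrite (score_againstE v0) SE.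
by rewrite (score_againstE v0) value_rec_le.
Qed.

End Game.

(* Main.v *)
Require Import Defs.
From mathcomp Require Import all_boot all_order all_algebra.
From mathcomp Require Import all_classical all_reals all_analysis.
From mathcomp Require Import ring lra.
Import Order.TTheory GRing.Theory Num.Theory.
Local Open Scope ring_scope.

(** Lower bound: if Norman always plays a fixed vertex [x], his score is
    [sum_y r_y gain(x, y)] whatever Rei does, and this is [n * excess x] for
    [r = n * 1].

    Upper bound: Rei chooses [y] with probability [r_y / k], where [k] is the
    number of remaining rounds.  With [m] vertices, let
    [W = sum_v (r_v - k/m)^2].  A round costs Rei at most
    [M/m + sum_v |r_v - k/m| / k <= M/m + W / k^(3/2) + m / (4 sqrt k)], with
    [M] the maximal excess, and the expected new value of [W] is at most
    [(1 - 2/k) W + 1].  Hence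
    [M k/m + W / sqrt k + (m/2 + 3) sqrt k] bounds the value of the game, by
    induction on [k]; at [r = n * 1] we have [W = 0] and [k = m n]. *)

(** * Gains summed over the vertices, and the lower bound *)

Section Gain.
Context {R : realType} {D : digraph}.
Implicit Types (x y v : D) (r : restriction D).

Lemma gainE x y : gain R x y = (y \in outN x)%:R - (y \in inN x)%:R.
Proof.
rewrite /gain !inE; case: ifP => [/arc_antisym/negPf ->|_].
  by rewrite subr0.
by case: ifP => _; rewrite sub0r /= ?oppr0.
Qed.

Lemma sum_gain x : \sum_y gain R x y = (excess x)%:~R.
Proof.
have card_sum (A : {set D}) : \sum_y (y \in A)%:R = #|A|%:R :> R.
  by under eq_bigr do rewrite mulrb; rewrite -big_mkcond/= sumr_const.
under eq_bigr do rewrite gainE.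
by rewrite sumrB !card_sum /excess rmorphB.
Qed.

Lemma norm_gain_le1 x y : `|gain R x y| <= 1.
Proof. by rewrite /gain; do 2?case: ifP => _; rewrite ?normrN ?normr1 ?normr0. Qed.

Lemma use_upE r y v : y \in supp r ->
  (use_up r y v)%:R = (r v)%:R - (v == y)%:R :> R.
Proof.
by rewrite inE ffunE => ry; rewrite natrB//; case: eqP => // ->.
Qed.

Lemma sum_pred1 (f : D -> R) y : \sum_v (v == y)%:R * f v = f y.
Proof.
rewrite (bigD1 y)//= eqxx mul1r big1 ?addr0// => v /negPf ->.
by rewrite mul0r.
Qed.

(** The constant choice [x] is one candidate in the [bigmax] of each round, and what it gains now is
    exactly what the sum loses when [r] becomes [use_up r y]. *)
Lemma le_value_rec v0 x k r : rounds r = k ->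
  \sum_y (r y)%:R * gain R x y <= value_rec R v0 k r.
Proof.
elim: k r => [|k IH] r rk.
  rewrite big1// => y _.
  have /eqP := rk; rewrite /rounds sum_nat_eq0 => /forallP/(_ y)/eqP ->.
  by rewrite mul0r.
have r0 : supp r != finset.set0 by rewrite -rounds_eq0 rk.
have [p [pr -> _]] := value_recS R v0 k r0.
rewrite /continuation.
set G := \sum_y _.
apply: (@le_trans _ _ (\sum_y p y * gain R x y + \sum_y p y * (G - gain R x y))).
  rewrite -big_split/=.
  under eq_bigr do rewrite -mulrDr addrC subrK.
  by rewrite -mulr_suml pmf_sum1 mul1r.
apply: lerD; first exact: (le_bigmax _ (fun x => \sum_y p y * gain R x y)).
apply: ler_sum => y _.
have [->|py] := eqVneq (p y) 0; first by rewrite !mul0r.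
have yr := pr _ py.
apply: ler_wpM2l; first exact: Defs.pmf_ge0.
apply: (le_trans _ (IH (use_up r y) _)); last first.
  by have /rounds_use_up := yr; rewrite rk => -[].
under eq_bigr do rewrite use_upE// mulrBl.
by rewrite sumrB sum_pred1.
Qed.

End Gain.

(** * Squared distance of [r] from its mean *)

Section Deviation.
Context {R : realType} {D : digraph}.
Implicit Types (x y v : D) (r : restriction D).

Let m : R := #|D|%:R.

Definition deviation r v : R := (r v)%:R - (rounds r)%:R / m.

Definition deviation2 r : R := \sum_v deviation r v ^+ 2.

Lemma deviation2_ge0 r : 0 <= deviation2 r.
Proof. by apply: sumr_ge0 => v _; exact: sqr_ge0. Qed.

Lemma card_digraph_gt0 (v0 : D) : 0 < m.
Proof. by rewrite ltr0n; apply/card_gt0P; exists v0. Qed.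

Lemma sum_cst (c : R) : \sum_(v : D) c = m * c.
Proof. by rewrite sumr_const mulr_natl. Qed.

Lemma sum_deviation (v0 : D) r : \sum_v deviation r v = 0.
Proof.
rewrite sumrB -natr_sum -/(rounds r) sum_cst mulrC divfK ?subrr//.
exact/lt0r_neq0/card_digraph_gt0.
Qed.

Lemma deviation_use_up r y v : y \in supp r ->
  deviation (use_up r y) v = deviation r v + m^-1 - (v == y)%:R.
Proof.
move=> yr; rewrite /deviation use_upE// (rounds_use_up yr) -natr1.
by rewrite mulrDl mul1r; ring.
Qed.

(** Since the deviations sum to 0, the uniform shift by [m^-1] leaves no cross term;
    [- 2 * deviation r y] comes from the entry [v = y]. *)
Lemma deviation2_use_up (v0 : D) r y : y \in supp r ->
  deviation2 (use_up r y) = deviation2 r + 1 - m^-1 - 2 * deviation r y.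
Proof.
move=> yr; rewrite /deviation2.
under eq_bigr => v _.
  rewrite deviation_use_up// (_ : _ ^+ 2 = deviation r v ^+ 2
    + (2 * m^-1) * deviation r v + m^-1 ^+ 2
    + (v == y)%:R * (1 - 2 * deviation r v - 2 * m^-1)); last first.
    by case: (v == y) => /=; ring.
  over.
rewrite !big_split/= sum_pred1 -mulr_sumr (sum_deviation v0) sum_cst.
have := lt0r_neq0 (card_digraph_gt0 v0); rewrite -/(deviation2 r) => m0.
by field.
Qed.

(** * Rei's play in proportion to the remaining counts *)

Lemma uniform_simplex r : supp r != finset.set0 ->
  simplex (supp r) (fun y => (r y)%:R / (rounds r)%:R : R).
Proof.
move=> r0; split=> [v||v].
- by rewrite divr_ge0 ?ler0n.
- by rewrite -mulr_suml -natr_sum divff// pnatr_eq0 rounds_eq0.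
- by rewrite inE; case: (r v) => //; rewrite mul0r eqxx.
Qed.

Lemma mean_deviation2_use_up (v0 : D) r : supp r != finset.set0 ->
  \sum_y (r y)%:R / (rounds r)%:R * deviation2 (use_up r y) =
  (1 - 2 / (rounds r)%:R) * deviation2 r + 1 - m^-1.
Proof.
move=> r0; have [_ p1 psupp] := uniform_simplex _ r0.
set k : R := (rounds r)%:R; set W := deviation2 r.
have m0 : m != 0 := lt0r_neq0 (card_digraph_gt0 v0).
have k0 : k != 0 by rewrite pnatr_eq0 rounds_eq0.
(* The weight of the term linear in the deviation is split as
   [r y / k = 1 / m + deviation r y / k]. *)
transitivity (\sum_y ((r y)%:R / k * (W + 1 - m^-1)
    + (- 2 / k) * deviation r y ^+ 2 + (- 2 / m) * deviation r y)).
  apply: eq_bigr => y _.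
  have [/eqP|py] := eqVneq ((r y)%:R / k) 0.
    (* Off the support the deviation is [- k / m], so the last two terms cancel. *)
    rewrite mulf_eq0 invr_eq0 (negPf k0) orbF => /eqP ry.
    by rewrite /deviation ry -/k; field; apply/andP.
  rewrite (deviation2_use_up v0) ?psupp//.
  rewrite /deviation -/k -/W; field; by apply/andP.
rewrite !big_split/= -mulr_suml p1 -!mulr_sumr (sum_deviation v0).
rewrite -/(deviation2 r) -/W.
by field; apply/andP.
Qed.

(** In [r y / k = 1 / m + deviation r y / k] the constant part yields [excess x / m]; the rest is
    bounded termwise, as gains are at most 1 in absolute value. *)
Lemma bigmax_uniform_le (v0 : D) r (s : R) : supp r != finset.set0 ->
  0 < s -> s ^+ 2 = (rounds r)%:R ->
  bigmax v0 (fun x => \sum_y (r y)%:R / (rounds r)%:R * gain R x y) <=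
  (max_excess v0)%:~R / m + (deviation2 r / s ^+ 3 + m / (4 * s)).
Proof.
move=> r0 s0 sk.
have [x ->] := bigmax_attained v0
  (fun x => \sum_y (r y)%:R / (rounds r)%:R * gain R x y).
have m0 : m != 0 := lt0r_neq0 (card_digraph_gt0 v0).
have k0 : (rounds r)%:R != 0 :> R by rewrite pnatr_eq0 rounds_eq0.
rewrite (_ : \sum_y _ = (excess x)%:~R / m
    + \sum_y deviation r y / s ^+ 2 * gain R x y); last first.
  rewrite -sum_gain mulr_suml -big_split/=; apply: eq_bigr => y _.
  by rewrite sk /deviation; field; apply/andP.
apply: lerD.
  rewrite ler_pM2r ?invr_gt0 ?card_digraph_gt0// ler_int.
  exact: max_excess_ge.
rewrite -[m / (4 * s)]sum_cst mulr_suml -big_split/=; apply: ler_sum => y _.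
set d := deviation r y.
have s1 : s != 0 := lt0r_neq0 s0.
apply: (@le_trans _ _ (`|d| / s ^+ 2)).
  apply: le_trans (ler_norm _) _; rewrite 2!normrM normfV (ger0_norm (sqr_ge0 s)).
  by rewrite ler_piMr ?norm_gain_le1// divr_ge0 ?sqr_ge0.
(* AM-GM: [`|d| / s^2 <= d^2 / s^3 + 1 / (4 s)] *)
rewrite -subr_ge0 (_ : _ - _ = (2 * `|d| - s) ^+ 2 / (4 * s ^+ 3)).
  by rewrite divr_ge0 ?sqr_ge0// mulr_ge0// exprn_ge0// ltW.
by rewrite -(real_normK (num_real d)); field.
Qed.

(** Here [s] and [t] stand for the roots of consecutive round counts. The terms in [W] and the
    others are bounded separately, both through [s - t = 1 / (s + t)]. *)
Lemma potential_step (s t W W' : R) : 1 <= t -> 0 < s -> s ^+ 2 = t ^+ 2 + 1 ->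
  0 <= W -> W' <= (1 - 2 / s ^+ 2) * W + 1 ->
  W / s ^+ 3 + m / (4 * s) + W' / t + (m / 2 + 3) * t <= W / s + (m / 2 + 3) * s.
Proof.
move=> t1 s0 st W0 W'le.
have t0 : 0 < t by exact: lt_le_trans t1.
have [tn0 sn0] := (lt0r_neq0 t0, lt0r_neq0 s0).
have ts : t <= s by nra.
have st_inv : (s - t) * (s + t) = 1 by rewrite -subr_sqr st; ring.
have hW : W / s ^+ 3 + (1 - 2 / s ^+ 2) * W / t <= W / s.
  (* As [t (s - t) <= (s + t) (s - t) = 1], the subtracted product is at most [t <= s]. *)
  have num_ge0 : 0 <= s - t ^+ 2 * (s - t).
    rewrite subr_ge0 (le_trans _ ts)// -[leRHS]mulr1 -st_inv expr2 -mulrA.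
    by rewrite ler_pM2l// mulrC ler_wpM2l ?subr_ge0// lerDr ltW.
  rewrite -subr_ge0 (_ : _ - _ = W * (s - t ^+ 2 * (s - t)) / (s ^+ 3 * t)).
    apply: divr_ge0; first exact: mulr_ge0.
    by rewrite mulr_ge0 ?exprn_ge0 ?ltW.
  have t2 : t ^+ 2 = s ^+ 2 - 1 by rewrite st addrK.
  rewrite (_ : s - _ = s - t ^+ 2 * s + t * t ^+ 2); last by ring.
  by rewrite t2; field; apply/andP.
(* The constant is fitted to [s - t >= 1 / (2 s)]: [m / 2] pays for [m / (4 s)], and 3 pays for
   [3 / (2 s) >= 1 / t]. *)
have hm : m / (4 * s) + t^-1 + (m / 2 + 3) * t <= (m / 2 + 3) * s.
  have m0 : 0 <= m by exact: ler0n.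
  have tV : t^-1 <= 3 / (2 * s).
    rewrite ler_pdivlMr ?mulr_gt0// mulrC ler_pdivrMr//.
    (* Squaring reduces the claim to [4 (t^2 + 1) <= 9 t^2]. *)
    rewrite -ler_sqr ?nnegrE ?mulr_ge0 ?(ltW s0) ?(ltW t0)// !exprMn st.
    by have := exprn_ege1 2 t1; lra.
  have sV : (2 * s)^-1 <= s - t.
    rewrite -(mul1r _^-1) ler_pdivrMr ?mulr_gt0// -[leLHS]st_inv.
    by rewrite ler_wpM2l ?subr_ge0//; lra.
  have : (m / 2 + 3) * (2 * s)^-1 <= (m / 2 + 3) * (s - t).
    by rewrite ler_wpM2l// addr_ge0// divr_ge0.
  have -> : m / (4 * s) = m / 2 * (2 * s)^-1 by field.
  lra.
have : W' / t <= ((1 - 2 / s ^+ 2) * W + 1) / t by rewrite ler_pM2r ?invr_gt0.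
rewrite mulrDl mul1r; lra.
Qed.

Lemma value_rec_le_potential (v0 : D) k r : rounds r = k ->
  value_rec R v0 k r <= (max_excess v0)%:~R * (k%:R / m)
    + (deviation2 r / Num.sqrt k%:R + (m / 2 + 3) * Num.sqrt k%:R).
Proof.
elim: k r => [|k IH] r rk.
  (* Division by [sqrt 0] gives 0 by convention, so the whole bound is 0. *)
  by rewrite sqrtr0 mul0r invr0 !mulr0 !addr0.
have r0 : supp r != finset.set0 by rewrite -rounds_eq0 rk.
pose q y : R := (r y)%:R / (rounds r)%:R.
have qr : simplex (supp r) q := uniform_simplex _ r0.
have [q0 q1 qsupp] := qr.
(* The value is a minimum over Rei's laws, so the law [q] bounds it from above. *)
have [_ [_ _ /(_ _ qr)/le_trans]] := value_recS R v0 k r0; apply.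
set M : R := (max_excess v0)%:~R; rewrite /continuation.
pose s : R := Num.sqrt k.+1%:R; pose t : R := Num.sqrt k%:R.
have s0 : 0 < s by rewrite sqrtr_gt0.
have ss : s ^+ 2 = (rounds r)%:R by rewrite sqr_sqrtr ?rk.
have cost_le : bigmax v0 (fun x => \sum_y q y * gain R x y) <=
    M / m + (deviation2 r / s ^+ 3 + m / (4 * s)).
  exact: bigmax_uniform_le.
set cost := bigmax _ _ in cost_le *; rewrite -/s.
set W := deviation2 r in cost_le *.
pose W' : R := \sum_y q y * deviation2 (use_up r y).
have W'le : W' <= (1 - 2 / s ^+ 2) * W + 1.
  rewrite /W' ss (mean_deviation2_use_up v0)// -/W gerDl oppr_le0 invr_ge0.
  exact/ltW/card_digraph_gt0.
have cont : \sum_y q y * value_rec R v0 k (use_up r y) <=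
    M * (k%:R / m) + (W' / t + (m / 2 + 3) * t).
  apply: (@le_trans _ _ (\sum_y (q y * (M * (k%:R / m) + (m / 2 + 3) * t)
      + q y * deviation2 (use_up r y) / t))).
    apply: ler_sum => y _.
    have [->|qy] := eqVneq (q y) 0; first by rewrite !mul0r addr0.
    have := IH (use_up r y) _; have /rounds_use_up := qsupp _ qy.
    rewrite rk => -[<-] /(_ erefl) /(ler_wpM2l (q0 y)).
    by rewrite -/M -/t; lra.
  rewrite big_split/= -[X in X + _ <= _]mulr_suml q1 mul1r.
  by rewrite -[X in _ + X <= _]mulr_suml -/W'; lra.
apply: le_trans (lerD cost_le cont) _.
have kM : M * (k.+1%:R / m) = M / m + M * (k%:R / m).
  by rewrite -natr1 mulrDl mul1r mulrDr addrC.
suff : W / s ^+ 3 + m / (4 * s) + W' / t + (m / 2 + 3) * t <= W / s + (m / 2 + 3) * s.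
  by rewrite kM; lra.
have m0 := card_digraph_gt0 v0.
case: (posnP k) => [k0|k_gt0].
  (* here [t = 0], and [W' / t] is the junk value [0] *)
  rewrite /t /s k0 sqrtr0 sqrtr1 invr0 mulr0 expr1n; lra.
apply: potential_step => //; last exact: deviation2_ge0.
  by rewrite -sqrtr1 ler_wsqrtr// ler1n.
by rewrite ss rk sqr_sqrtr// natr1.
Qed.

End Deviation.

(** * Both bounds at constant restriction vectors *)

Theorem theorem1p2 (R : realType) (D : digraph) (v0 : D) :
  exists C : R, 0 < C /\
    forall n : nat, (1 <= n)%N ->
      (max_excess v0)%:~R * n%:R <= game_value R ([ffun=> n] : restriction D) /\
      game_value R ([ffun=> n] : restriction D) <=
        (max_excess v0)%:~R * n%:R + C * Num.sqrt (n%:R : R).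
Proof.
set m : R := #|D|%:R; have m0 : 0 < m := card_digraph_gt0 v0.
(* The factor [sqrt m] comes from the [m n] rounds: [sqrt (m n) = sqrt m sqrt n]. *)
exists ((m / 2 + 3) * Num.sqrt m); split.
  by rewrite mulr_gt0 ?sqrtr_gt0// addr_gt0// divr_gt0.
move=> n _; set r : restriction D := [ffun=> n]; rewrite (game_valueE R v0); split.
  have [x ->] := max_excess_attained v0; rewrite -sum_gain mulr_suml.
  apply: le_trans (le_value_rec v0 x (rounds r) r erefl).
  by apply: ler_sum => y _; rewrite ffunE mulrC.
have rk : (rounds r)%:R = m * n%:R :> R.
  by rewrite natr_sum; under eq_bigr do rewrite ffunE; rewrite sum_cst.
apply: le_trans (value_rec_le_potential v0 _ _ erefl) _.
rewrite /deviation2 big1 => [|y _]; last first.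
  by rewrite /deviation rk ffunE mulrAC divff ?lt0r_neq0// mul1r subrr expr0n.
rewrite mul0r add0r rk mulrAC divff ?lt0r_neq0// mul1r sqrtrM ?(ltW m0)//.
by rewrite -/m mulrA.
Qed.
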